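(* Let $\nu$ be a probability measure on $\mathcal{X}$ and let $\rho$ be the probability measure $\frac1Z\det(G^{\boldsymbol{x}})\,\mathrm{d}\nu^{\otimes n}(\boldsymbol{x})$ on $\mathcal{X}^n$ with $Z=\int\det(G^{\boldsymbol{x}})\,\mathrm{d}\nu^{\otimes n}(\boldsymbol{x})>0$. Let $\tilde\rho$ denote the marginal distribution of $\rho$ with respect to any one variable. Suppose that $\boldsymbol{x}\in\mathcal{X}^n$ is distributed according to $\rho$ and $\tilde{\boldsymbol{x}}\in\mathcal{X}^n$ is distributed according to the product measure $\tilde\rho^{\otimes n}$. Then $$\mathbb{E}\bigl[\log\det G^{\boldsymbol{x}}\bigr]\ge\mathbb{E}\bigl[\log\det G^{\tilde{\boldsymbol{x}}}\bigr].$$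
   Context: $\mathcal{V}$ is a real reproducing kernel Hilbert space of functions on $\mathcal{X}$ with inner product $(\cdot,\cdot)_{\mathcal{V}}$ and reproducing kernel $k$; $\mathcal{V}_d\subseteq\mathcal{V}$ is a fixed $d$-dimensional subspace with $\mathcal{V}$-orthonormal basis $b_1,\dots,b_d$. For $\boldsymbol{x}=(x_1,\dots,x_n)\in\mathcal{X}^n$, $P_{\mathcal{V}_{\boldsymbol{x}}}$ is the $\mathcal{V}$-orthogonal projection onto $\mathcal{V}_{\boldsymbol{x}}:=\operatorname{span}\{k(x_1,\cdot),\dots,k(x_n,\cdot)\}$ and $G^{\boldsymbol{x}}\in\mathbb{R}^{d\times d}$ is defined by $G^{\boldsymbol{x}}_{jk}:=(P_{\mathcal{V}_{\boldsymbol{x}}}b_j,b_k)_{\mathcal{V}}$. The density $\det(G^{\boldsymbol{x}})$ is invariant under permutations of the points, so all one-variable marginals of $\rho$ coincide. Convention: $\log0=-\infty$. *)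

(* Defs.v *)
From HB Require Import structures.
From mathcomp Require Import all_boot all_order all_algebra sesquilinear.
From mathcomp Require Import all_classical all_reals all_analysis.

Set Implicit Arguments.
Unset Strict Implicit.
Unset Printing Implicit Defensive.
Import Order.TTheory GRing.Theory Num.Theory.
Import numFieldNormedType.Exports.

Local Open Scope classical_set_scope.
Local Open Scope ring_scope.

(* A vector of the complete space [rkhs_space] stands for the real function on X
   that [rkhs_eval] assigns to it; [rkhs_section x] is the vector whose function
   is k(x, -). *)
Record rkhs (R : realType) (X : Type) := Rkhs {
  rkhs_space :> completeNormedModType R ;
  rkhs_eval : {linear rkhs_space -> (X -> R)} ;
  rkhs_eval_inj : injective rkhs_eval ;
  rkhs_dot : {dot rkhs_space for idfun} ;
  rkhs_normE : forall f : rkhs_space, `|f| = Num.sqrt (rkhs_dot f f) ;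
  rkhs_kernel : X -> X -> R ;
  rkhs_section : X -> rkhs_space ;
  rkhs_sectionE : forall x, rkhs_eval (rkhs_section x) = rkhs_kernel x ;
  rkhs_reproducing : forall (f : rkhs_space) x,
    rkhs_eval f x = rkhs_dot f (rkhs_section x)
}.

Definition lin_span (R : realType) (V : lmodType R) (m : nat) (v : 'I_m -> V) :
    set V :=
  [set u | exists c : 'I_m -> R, u = \sum_(i < m) c i *: v i].

(* A subspace that has an orthonormal basis with d elements has dimension d. *)
Definition orthonormal_basis (R : realType) (X : Type) (V : rkhs R X) (d : nat)
    (W : set V) (b : 'I_d -> V) : Prop :=
  (forall i j, rkhs_dot V (b i) (b j) = (i == j)%:R) /\ W = lin_span b.

(* The value 0 is taken only if u has no orthogonal projection onto W, which
   cannot happen for a finite-dimensional W. *)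
Definition orth_proj (R : realType) (X : Type) (V : rkhs R X) (W : set V)
    (u : V) : V :=
  xget 0 [set p | W p /\ forall w, W w -> rkhs_dot V (u - p) w = 0].

Definition kernel_span (R : realType) (X : Type) (V : rkhs R X) (n : nat)
    (x : n.-tuple X) : set V :=
  lin_span (fun i : 'I_n => rkhs_section V (tnth x i)).
Arguments kernel_span {R X} V {n} x.

Definition Gmx (R : realType) (X : Type) (V : rkhs R X) (d n : nat)
    (b : 'I_d -> V) (x : n.-tuple X) : 'M[R]_d :=
  \matrix_(j, k) rkhs_dot V (orth_proj (kernel_span V x) (b j)) (b k).

Section tuple_measures.
Context {dX : measure_display} {X : measurableType dX} {R : realType}.

Definition cons_pair (n : nat) (p : X * n.-tuple X) : n.+1.-tuple X :=
  [tuple of p.1 :: p.2].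

Lemma measurable_cons_pair n :
  measurable_fun [set: X * n.-tuple X] (@cons_pair n).
Proof. exact: (measurable_cons measurable_fst measurable_snd). Qed.

HB.instance Definition _ n :=
  isMeasurableFun.Build _ _ _ _ (@cons_pair n) (@measurable_cons_pair n).

Fixpoint tuple_prob (mu : probability X R) (n : nat) :
    probability (n.-tuple X) R :=
  match n with
  | 0%N => dirac [tuple]
  | m.+1 => distribution (mu \x tuple_prob mu m)%E (@cons_pair m)
  end.

Lemma tuple_prob_box (mu : probability X R) (n : nat) (A : 'I_n -> set X) :
  (forall i, measurable (A i)) ->
  tuple_prob mu n [set x | forall i, A i (tnth x i)] =
  (\prod_(i < n) mu (A i))%E.
Proof.
elim: n A => [|n IHn] A mA.
  rewrite big_ord0 /= (_ : [set x | _] = setT) ?probability_setT//.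
  by apply/seteqP; split => // x _ [].
rewrite big_ord_recl /= /distribution /pushforward /=.
rewrite (_ : _ @^-1` _ = A ord0 `*`
    [set x : n.-tuple X | forall i, A (lift ord0 i) (tnth x i)]).
  rewrite product_measure1E//=; first by congr (_ * _)%E; exact: IHn.
  have -> : [set x : n.-tuple X | forall i, A (lift ord0 i) (tnth x i)] =
      \bigcap_(i in [set: 'I_n]) ((@tnth n X ^~ i) @^-1` A (lift ord0 i)).
    by apply/seteqP; split => x /= h i; [move=> _; exact: h|exact: h].
  apply: fin_bigcap_measurable => // i _.
  by rewrite -[X in measurable X]setTI; exact: measurable_tnth.
apply/seteqP; split => [[a x]/= h|[a x]/= [h0 h] i].
  split; first exact: (h ord0).
  by move=> i; have := h (lift ord0 i); rewrite tnthS.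
by case: (unliftP ord0 i) => [j ->|->] //; rewrite /cons_pair tnthS; exact: h.
Qed.

Definition coord (n : nat) (i : 'I_n) (x : n.-tuple X) : X := tnth x i.

HB.instance Definition _ n (i : 'I_n) :=
  isMeasurableFun.Build _ _ _ _ (@coord n i) (measurable_tnth i).

Definition marginal (n : nat) (rho : probability (n.-tuple X) R) (i : 'I_n) :
    probability X R :=
  distribution rho (coord i).

End tuple_measures.

(* Main.v *)
Require Import Defs.
From HB Require Import structures.
From mathcomp Require Import all_boot all_order all_algebra sesquilinear perm.
From mathcomp Require Import measurable_realfun ring lra.
From mathcomp Require Import all_classical all_reals all_analysis.
Set Implicit Arguments.
Unset Strict Implicit.
Unset Printing Implicit Defensive.
Import Order.TTheory GRing.Theory Num.Theory.
Import numFieldNormedType.Exports.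
Local Open Scope classical_set_scope.
Local Open Scope ring_scope.

(** Write D x for det G^x.  It is a Gram determinant, so D >= 0; the entries of
    G^x lie in [-1, 1], so D <= d!; and it depends only on the set of the points
    of x, so it is symmetric.

    Let p = D / Z be the density of rho with respect to nu^n, let w be the
    density of the common marginal mu with respect to nu, and let
    q x = \prod_j w (x_j), which is the density of mu^n with respect to nu^n.
    Since ln is increasing, pointwise

      (p - q) (ln D - ln (Z q)) >= 0.

    Integrating, \int q ln D <= \int p ln D + (\int q L - \int p L), where
    L = ln (Z q) = ln Z + \sum_j ln (w (x_j)).  The bracket is zero: L is a
    constant plus a sum of functions of one coordinate each, and rho = p nu^n
    and mu^n = q nu^n have the same one-coordinate marginals.  What remains is
    E_(mu^n) log D <= E_rho log D, which is the claim.

    The terms \int p L, \int q L and \int p ln D are finite by boundedness: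
    w <= d! / Z, and t ln t is bounded on bounded intervals, so ln w is
    mu-integrable and D ln D is bounded.  The left-hand side may be -oo.  The pointwise inequality may fail where q = 0 < p, but
    this is a null set, because rho {w (x_j) = 0} = mu {w = 0} = 0 for each j.

    The pointwise inequality is [lne_exchange_le], its integrated form
    [lne_cross_entropy_le], and [exchangeable_marginals_lne_le] is the theorem
    for an arbitrary bounded symmetric density. *)

(** * Determinants *)

(** If det A < 0, the characteristic polynomial of - A is negative at 0 and
    positive far to the right, so it has a root t > 0.  An eigenvector v then
    satisfies v A v^T = - t |v|^2 < 0. *)
Lemma det_psd_ge0 (R : rcfType) (n : nat) (A : 'M[R]_n) :
  (forall v : 'rV_n, 0 <= (v *m A *m v^T) 0 0) -> 0 <= \det A.
Proof.
move=> psd; rewrite leNgt; apply/negP => detA_lt0.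
have p0 : (char_poly (- A)).[0] = \det A.
  rewrite -[_.[0]]horner_evalE -det_map_mx; congr (\det _).
  by apply/matrixP => i j; rewrite !mxE /= horner_evalE !hornerE hornerMn
    hornerX mul0rn sub0r opprK.
have [B Bpos] := monic_Cauchy_bound (char_poly_monic (- A)).
pose c := Num.max B 0.
have [||t /andP[t_ge0 _] roott] := @poly_ivt R (char_poly (- A)) 0 c.
- by rewrite le_max lexx orbT.
- by rewrite p0 (ltW detA_lt0) ltW// Bpos// le_max lexx.
have t_gt0 : 0 < t.
  rewrite lt_neqAle t_ge0 andbT; apply/eqP => t0.
  by move: roott; rewrite -t0 rootE p0 lt_eqF.
move: roott; rewrite -eigenvalue_root_char => /eigenvalueP[v vA v_neq0].
have := psd v.
have -> : v *m A = - t *: v by rewrite scaleNr -vA mulmxN opprK.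
rewrite -scalemxAl mxE mulNr oppr_ge0 pmulr_rle0// mxE => vv.
have vv0 : \sum_j v 0 j * v^T j 0 == 0.
  rewrite eq_le vv; apply: sumr_ge0 => j _.
  by rewrite mxE -expr2 sqr_ge0.
move: vv0; rewrite psumr_eq0; last first.
  by move=> j _; rewrite mxE -expr2 sqr_ge0.
move/allP => vv0; case/eqP: v_neq0; apply/rowP => j.
have := vv0 j (mem_index_enum _); rewrite /= !mxE mulf_eq0 orbb.
by move/eqP.
Qed.

Lemma norm_det_le_fact (R : numDomainType) (n : nat) (A : 'M[R]_n) :
  (forall i j, `|A i j| <= 1) -> `|\det A| <= n`!%:R.
Proof.
move=> A1; apply: (le_trans (ler_norm_sum _ _ _)).
apply: (@le_trans _ _ (\sum_(s : 'S_n) 1)).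
  apply: ler_sum => s _; rewrite normrM normrX normrN1 expr1n mul1r normr_prod.
  by apply: prodr_ile1 => i _; rewrite normr_ge0 A1.
by rewrite sumr_const card_Sn.
Qed.

(** * Orthogonal projection onto a finite span *)

Section orthogonal_projection.
Context {R : realType} {X : Type} (V : rkhs R X).
Local Notation "''[' u , v ]" := (rkhs_dot V u v).

Lemma rkhs_dotC (u v : V) : '[u, v] = '[v, u].
Proof. by rewrite hermC expr0 mul1r. Qed.

Lemma rkhs_dot_ge0 (u : V) : 0 <= '[u, u].
Proof.
have [->|u0] := eqVneq u 0; first by rewrite linear0l.
exact/ltW/neq0_dnorm_gt0.
Qed.

Lemma lin_span_comb (m : nat) (v : 'I_m -> V) (a : R) (u1 u2 : V) :
  lin_span v u1 -> lin_span v u2 -> lin_span v (a *: u1 + u2).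
Proof.
move=> [c1 ->] [c2 ->]; exists (fun i => a * c1 i + c2 i).
rewrite scaler_sumr -big_split /=; apply: eq_bigr => i _.
by rewrite scalerDl scalerA.
Qed.

(** Gram-Schmidt: if e is the component of v_0 orthogonal to the span of the
    other vectors, the projection of u onto the whole span is the projection
    onto the span of the others plus the component of u along e. *)
Lemma lin_span_projection (m : nat) (v : 'I_m -> V) (u : V) :
  exists p, lin_span v p /\ forall w, lin_span v w -> '[u - p, w] = 0.
Proof.
elim: m v u => [|m IHm] v u.
  exists 0; split; first by exists (fun=> 0); rewrite big_ord0.
  by move=> w [c ->]; rewrite big_ord0 linear0r.
pose v' i := v (lift ord0 i).
have span' w : lin_span v' w -> lin_span v w.
  move=> [c ->]; exists (fun i => oapp c 0 (unlift ord0 i)).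
  rewrite big_ord_recl unlift_none scale0r add0r.
  by apply: eq_bigr => i _; rewrite liftK.
have [p' [p'v p'o]] := IHm v' u.
have [r [rv ro]] := IHm v' (v ord0).
pose e := v ord0 - r.
have spanE w : lin_span v w -> exists a w', lin_span v' w' /\ w = a *: e + w'.
  move=> [c ->]; exists (c ord0), (c ord0 *: r + \sum_(i < m) c (lift ord0 i) *: v' i).
  split; last by rewrite big_ord_recl /e scalerBr addrA subrK.
  by apply: lin_span_comb => //; exists (fun i => c (lift ord0 i)).
have ev : lin_span v e.
  rewrite /e addrC -scaleN1r; apply: lin_span_comb; first exact: span'.
  exists (fun i => (i == ord0)%:R); rewrite big_ord_recl eqxx scale1r.
  by rewrite big1 ?addr0// => i _; rewrite scale0r.
(* If e = 0 then v_0 already lies in the span of the others; c * e = 0 whatever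
   the value of c, so this case needs no separate witness. *)
pose c := '[u, e] / '[e, e].
exists (c *: e + p'); split.
  by apply: lin_span_comb => //; exact: span'.
have upe : '[u - (c *: e + p'), e] = 0.
  have [->|e0] := eqVneq e 0; first by rewrite linear0r.
  rewrite linearBl linearPl /= divfK; last by rewrite gt_eqF// neq0_dnorm_gt0.
  by rewrite (rkhs_dotC p') (ro _ p'v) addr0 subrr.
move=> w /spanE[a [w' [w'v ->]]].
rewrite linearPr /= upe mulr0 add0r opprD addrCA linearDl linearNl linearZl_LR /=.
by rewrite (ro _ w'v) (p'o _ w'v) mulr0 oppr0 addr0.
Qed.

Lemma orth_projP (m : nat) (v : 'I_m -> V) (u : V) :
  lin_span v (orth_proj (lin_span v) u) /\
  forall w, lin_span v w -> '[u - orth_proj (lin_span v) u, w] = 0.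
Proof.
rewrite /orth_proj; have [p pP] := lin_span_projection v u.
pose S := [set q | lin_span v q /\ forall w, lin_span v w -> '[u - q, w] = 0].
by suff : S (xget 0 S) by []; apply: xgetPex; exists p.
Qed.

(** Turns G^x into the Gram matrix of the projected vectors: (P u1, u2) =
    (P u1, P u2) because u2 - P u2 is orthogonal to P u1. *)
Lemma orth_proj_dot (m : nat) (v : 'I_m -> V) (u1 u2 : V) :
  '[orth_proj (lin_span v) u1, u2] =
  '[orth_proj (lin_span v) u1, orth_proj (lin_span v) u2].
Proof.
have [p1v _] := orth_projP v u1; have [_ /(_ _ p1v)] := orth_projP v u2.
by rewrite linearBl rkhs_dotC => /eqP; rewrite subr_eq0 => /eqP ->; rewrite rkhs_dotC.
Qed.

Lemma orth_proj_norm_le (m : nat) (v : 'I_m -> V) (u : V) :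
  '[orth_proj (lin_span v) u, orth_proj (lin_span v) u] <= '[u, u].
Proof.
set p := orth_proj _ u.
have pu : '[p, u] = '[p, p] by exact: orth_proj_dot.
have := rkhs_dot_ge0 (u - p).
rewrite linearBl !linearBr /= (rkhs_dotC u p) pu.
by rewrite subrr subr0 subr_ge0.
Qed.

End orthogonal_projection.

(** * The determinant of G^x: sign, bound, symmetry *)

Section gram_determinant.
Context {R : realType} {X : Type} (V : rkhs R X) (d n : nat).
Local Notation "''[' u , v ]" := (rkhs_dot V u v).

Lemma det_Gmx_ge0 (b : 'I_d -> V) (x : n.-tuple X) : 0 <= \det (Gmx b x).
Proof.
apply: det_psd_ge0 => v.
pose p j := orth_proj (kernel_span V x) (b j).
have -> : (v *m Gmx b x *m v^T) 0 0 =
    '[\sum_j v 0 j *: p j, \sum_j v 0 j *: p j].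
  rewrite linear_sumr mxE; apply: eq_bigr => k _.
  rewrite linearZr_LR /= linear_sumlz /= !mxE mulrC; congr (_ * _).
  apply: eq_bigr => j _; rewrite linearZl_LR /= mxE; congr (_ * _).
  exact: orth_proj_dot.
exact: rkhs_dot_ge0.
Qed.

(** By the Leibniz formula it is enough that the entries are at most 1 in
    absolute value.  Expanding |P b_j + P b_k|^2 >= 0 and |P b_j - P b_k|^2 >= 0
    gives 2 |(P b_j, P b_k)| <= |P b_j|^2 + |P b_k|^2 <= 2. *)
Lemma det_Gmx_le (b : 'I_d -> V) (x : n.-tuple X) :
  (forall j, '[b j, b j] <= 1) -> \det (Gmx b x) <= d`!%:R.
Proof.
move=> b1; apply: (le_trans (ler_norm _)); apply: norm_det_le_fact => j k.
pose p j := orth_proj (kernel_span V x) (b j).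
have p1 l : '[p l, p l] <= 1.
  exact: (le_trans (orth_proj_norm_le _ _)).
rewrite mxE [X in `|X|]orth_proj_dot -!/(p _).
have := rkhs_dot_ge0 (p j - p k); have := rkhs_dot_ge0 (p j + p k).
rewrite linearBl !linearBr linearDl !linearDr /= (rkhs_dotC (p k) (p j)).
have := p1 j; have := p1 k; rewrite ler_norml.
move: '[p j, p k] '[p j, p j] '[p k, p k] => r s t ? ? ? ?.
by apply/andP; split; lra.
Qed.

Lemma Gmx_perm (b : 'I_d -> V) (x : n.-tuple X) (s : 'S_n) :
  Gmx b [tuple tnth x (s i) | i < n] = Gmx b x.
Proof.
suff spanE : kernel_span V [tuple tnth x (s i) | i < n] = kernel_span V x.
  by apply/matrixP => j k; rewrite !mxE spanE.
apply/seteqP; split => _ [c ->].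
  exists (fun i => c (s^-1%g i)); rewrite [RHS](reindex_inj (@perm_inj _ s)) /=.
  by apply: eq_bigr => i _; rewrite permK tnth_mktuple.
exists (fun i => c (s i)); rewrite (reindex_inj (@perm_inj _ s)) /=.
by apply: eq_bigr => i _; rewrite tnth_mktuple.
Qed.

End gram_determinant.
(** * Integration against a density, and laws of random variables *)

Section density.
Local Open Scope ereal_scope.
Context {d : measure_display} {T : measurableType d} {R : realType}.
Variables (m mu : probability T R) (p : T -> R).
Hypotheses (p_ge0 : forall x, (0 <= p x)%R) (mp : measurable_fun [set: T] p)
  (mE : forall A, measurable A -> m A = \int[mu]_(x in A) (p x)%:E).

(** The change of variables holds for the Radon-Nikodym derivative of m, and p
    agrees with that derivative almost everywhere. *)
Lemma ge0_integral_density (f : T -> \bar R) :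
  measurable_fun [set: T] f -> (forall x, 0 <= f x) ->
  \int[m]_x f x = \int[mu]_x (f x * (p x)%:E).
Proof.
move=> mf f0.
have numu : m `<< mu.
  apply/null_content_dominatesP => A mA A0; rewrite mE//.
  by apply: null_set_integral => //; exact/measurable_funTS/measurable_EFinP.
rewrite -(Radon_Nikodym_SigmaFinite.change_of_variables numu) //.
have mq : measurable_fun [set: T] (Radon_Nikodym_SigmaFinite.f m mu).
  by apply: (measurable_int mu); exact: Radon_Nikodym_SigmaFinite.f_integrable.
have q0 x : 0 <= Radon_Nikodym_SigmaFinite.f m mu x.
  exact: Radon_Nikodym_SigmaFinite.f_ge0.
have pq : ae_eq mu setT (Radon_Nikodym_SigmaFinite.f m mu) (EFin \o p).
  apply: integral_ae_eq => //.
  - exact: Radon_Nikodym_SigmaFinite.f_integrable.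
  - exact/measurable_EFinP.
  - move=> E _ mEE; rewrite -Radon_Nikodym_SigmaFinite.f_integral//.
    exact: mE.
apply: ge0_ae_eq_integral => //.
- exact: emeasurable_funM.
- by apply: emeasurable_funM => //; exact/measurable_EFinP.
- by move=> x _; rewrite mule_ge0.
- by move=> x _; rewrite mule_ge0// lee_fin.
- by apply: filterS pq => x + _ => ->.
Qed.

(** The integral of any measurable f is the difference of the integrals of its
    positive and negative parts, and multiplication by p >= 0 commutes with
    taking these parts.  The formula is applied to log det, whose integral may
    be -oo. *)
Lemma integral_density (f : T -> \bar R) :
  measurable_fun [set: T] f ->
  \int[m]_x f x = \int[mu]_x (f x * (p x)%:E).
Proof.
move=> mf; rewrite integralE [RHS]integralE; congr (_ - _).
- rewrite ge0_integral_density//; last exact: measurable_funepos.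
  by apply: eq_integral => x _; rewrite !funeposE maxe_pMl ?mul0e ?lee_fin.
- rewrite ge0_integral_density//; last exact: measurable_funeneg.
  by apply: eq_integral => x _; rewrite !funenegE maxe_pMl ?mul0e ?lee_fin// mulNe.
Qed.

Lemma integrable_density (f : T -> \bar R) :
  m.-integrable setT f -> mu.-integrable setT (fun x => f x * (p x)%:E).
Proof.
move=> /integrableP[mf foo]; apply/integrableP; split.
  by apply: emeasurable_funM => //; exact/measurable_EFinP.
move: foo; rewrite ge0_integral_density//; last exact: measurableT_comp.
by under [X in _ -> X < _]eq_integral do rewrite abseM /= (ger0_norm (p_ge0 _)).
Qed.

End density.

(** Monotonicity for functions whose integral may be infinite: f <= g gives
    f^+ <= g^+ and g^- <= f^-, and the convention for oo - oo makes the difference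
    monotone in all cases. *)
Lemma le_integral_ae d (T : measurableType d) (R : realType)
    (mu : {measure set T -> \bar R}) (f g : T -> \bar R) :
  measurable_fun [set: T] f -> measurable_fun [set: T] g ->
  {ae mu, forall x, (f x <= g x)%E} ->
  (\int[mu]_x f x <= \int[mu]_x g x)%E.
Proof.
move=> mf mg fg; rewrite integralE [leRHS]integralE; apply: leeB.
- apply: ae_ge0_le_integral => //; do ?exact: measurable_funepos.
  by apply: filterS fg => x fgx _; rewrite !funeposE; apply: le_max2.
- apply: ae_ge0_le_integral => //; do ?exact: measurable_funeneg.
  by apply: filterS fg => x fgx _; rewrite !funenegE; apply: le_max2; rewrite ?leeN2.
Qed.

(** Like [integral_density], for integrals that may be infinite. *)
Lemma integral_rv_law d d' (T : measurableType d) (T' : measurableType d')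
    (R : realType) (P : probability T R) (X : {RV P >-> T'}) (f : T' -> \bar R) :
  measurable_fun [set: T'] f ->
  (\int[distribution P X]_y f y = \int[P]_x f (X x))%E.
Proof.
move=> mf; rewrite integralE [RHS]integralE -[fun x => f (X x)]/(f \o X).
congr (_ - _)%E.
- rewrite [in RHS]funepos_comp.
  exact: (ge0_integral_distribution X (measurable_funepos mf) (funepos_ge0 f)).
- rewrite [in RHS]funeneg_comp.
  exact: (ge0_integral_distribution X (measurable_funeneg mf) (funeneg_ge0 f)).
Qed.

Lemma measurable_lne_EFin d (T : measurableType d) (R : realType) (f : T -> R) :
  measurable_fun [set: T] f -> measurable_fun [set: T] (fun x => lne (f x)%:E).
Proof.
move=> mf.
rewrite (_ : (fun x => _) = (fun x => if (0 < f x)%R then (ln (f x))%:E else -oo%E)).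
  apply: measurable_fun_ifT => //.
    exact: measurable_fun_ltr.
  by apply/measurable_EFinP; exact: measurableT_comp.
apply/funext => x; case: ltP => fx; first by rewrite lne_EFin.
by rewrite le0_lneNy// lee_fin.
Qed.
(** * Product measures on tuples *)

Section tuple_measure.
Context {dX : measure_display} {X : measurableType dX} {R : realType}.

Definition box (n : nat) (A : 'I_n -> set X) : set (n.-tuple X) :=
  [set x | forall i, A i (tnth x i)].

Lemma measurable_box (n : nat) (A : 'I_n -> set X) :
  (forall i, measurable (A i)) -> measurable (box A).
Proof.
move=> mA.
have -> : box A = \bigcap_(i in [set: 'I_n]) ((@tnth n X ^~ i) @^-1` A i).
  by apply/seteqP; split => x /= h i; [move=> _; exact: h|exact: h].
apply: fin_bigcap_measurable => // i _.
by rewrite -[X in measurable X]setTI; exact: measurable_tnth.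
Qed.

(** Boxes are stable under intersection and generate the product
    sigma-algebra. *)
Lemma eq_measure_box (n : nat) (m1 m2 : probability (n.-tuple X) R) :
  (forall A : 'I_n -> set X, (forall i, measurable (A i)) ->
     m1 (box A) = m2 (box A)) ->
  forall B, measurable B -> m1 B = m2 B.
Proof.
move=> m12 B mB.
pose G := [set C | exists2 A : 'I_n -> set X,
  (forall i, measurable (A i)) & C = box A].
have boxT : box (fun=> setT : set X) = [set: n.-tuple X].
  by apply/seteqP; split => // x _ i.
have Gm : G `<=` measurable by move=> _ [A mA ->]; exact: measurable_box.
apply: (g_sigma_algebra_measure_unique G Gm (fun=> setT)).
- by move=> _; exists (fun=> setT).
- by apply/seteqP; split => // x _; exists 0%N.
- move=> _ _ [A1 mA1 ->] [A2 mA2 ->]; exists (fun i => A1 i `&` A2 i).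
    by move=> i; exact: measurableI.
  apply/seteqP; split => [x [h1 h2] i|x h]; first by split; [exact: h1|exact: h2].
  by split => i; have [] := h i.
- by move=> _ [A mA ->]; exact: m12.
- by move=> _; rewrite /= probability_setT ltry.
(* Every product-measurable set is in the sigma-algebra generated by the boxes:
   the identity from that sigma-algebra to the product one is measurable, since
   each of its coordinates is. *)
have mid : measurable_fun [set: g_sigma_algebraType G]
    (idfun : g_sigma_algebraType G -> n.-tuple X).
  apply/measurable_fun_tnthP => i _ C mC; rewrite setTI.
  apply: sub_sigma_algebra; exists (fun j => if j == i then C else setT).
    by move=> j; case: ifP.
  apply/seteqP; split => [x Cx j|x /(_ i)]; last by rewrite eqxx.
  by case: eqP => // ->.
by have := mid measurableT _ mB; rewrite setTI.
Qed.

Lemma ge0_integral_tuple_cons (mu : probability X R) (n : nat)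
    (f : n.+1.-tuple X -> \bar R) :
  measurable_fun [set: n.+1.-tuple X] f -> (forall x, 0 <= f x)%E ->
  (\int[tuple_prob mu n.+1]_x f x =
   \int[mu]_a \int[tuple_prob mu n]_y f (cons_pair (a, y)))%E.
Proof.
move=> mf f0; rewrite [LHS]ge0_integral_distribution//.
rewrite (fubini_tonelli1 (f \o @cons_pair _ X n)) //.
  exact: measurableT_comp.
by move=> z; exact: f0.
Qed.

(** By Tonelli, the density w of the first coordinate comes out of the inner
    integral, and the density of the remaining coordinates is known by induction
    on n. *)
Lemma ge0_integral_tuple_density (mu nu : probability X R) (w : X -> R) (n : nat)
    (f : n.-tuple X -> \bar R) :
  (forall a, 0 <= w a) -> measurable_fun [set: X] w ->
  (forall A, measurable A -> mu A = \int[nu]_(a in A) (w a)%:E)%E ->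
  measurable_fun [set: n.-tuple X] f -> (forall x, 0 <= f x)%E ->
  (\int[tuple_prob mu n]_x f x =
   \int[tuple_prob nu n]_x (f x * (\prod_(j < n) w (tnth x j))%:E))%E.
Proof.
move=> w0 mw muE; elim: n f => [|n IHn] f mf f0.
  by apply: eq_integral => x _; rewrite big_ord0 mule1.
have mprod k : measurable_fun [set: k.-tuple X] (fun x => \prod_(j < k) w (tnth x j)).
  apply: measurable_prod => j _; apply: measurableT_comp => //; exact: measurable_tnth.
have prod0 k (x : k.-tuple X) : 0 <= \prod_(j < k) w (tnth x j).
  by apply: prodr_ge0.
have mfc : measurable_fun [set: X * n.-tuple X] (f \o @cons_pair _ X n).
  exact: measurableT_comp.
pose g z : \bar R := (f (cons_pair z) * (\prod_(j < n) w (tnth z.2 j))%:E)%E.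
have mg : measurable_fun [set: X * n.-tuple X] g.
  apply: emeasurable_funM => //; apply/measurable_EFinP.
  exact: (measurableT_comp (mprod n)).
have g0 z : (0 <= g z)%E by rewrite mule_ge0// lee_fin.
rewrite ge0_integral_tuple_cons// [RHS]ge0_integral_tuple_cons; last 2 first.
- by apply: emeasurable_funM => //; apply/measurable_EFinP; exact: mprod.
- by move=> x; rewrite mule_ge0// lee_fin.
transitivity (\int[mu]_a \int[tuple_prob nu n]_y g (a, y))%E.
  apply: eq_integral => a _; rewrite IHn//.
  by apply: (measurableT_comp mfc); exact: measurable_pair1.
rewrite (ge0_integral_density w0 mw muE); last 2 first.
- exact: (measurable_fun_fubini_tonelli_F g).
- by move=> a; exact: integral_ge0.
apply: eq_integral => a _.
rewrite -ge0_integralZr//; last 2 first.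
- by apply: (measurableT_comp mg); exact: measurable_pair1.
- by rewrite lee_fin.
apply: eq_integral => y _; rewrite /g -muleA -EFinM big_ord_recl mulrC.
congr (_ * (_ * _)%:E)%E.
by apply: eq_bigr => j _; rewrite [in RHS]/cons_pair tnthS.
Qed.

Lemma tuple_prob_density (mu nu : probability X R) (w : X -> R) (n : nat) :
  (forall a, 0 <= w a) -> measurable_fun [set: X] w ->
  (forall A, measurable A -> mu A = \int[nu]_(a in A) (w a)%:E)%E ->
  forall A : set (n.-tuple X), measurable A ->
  (tuple_prob mu n A =
   \int[tuple_prob nu n]_(x in A) (\prod_(j < n) w (tnth x j))%:E)%E.
Proof.
move=> w0 mw muE A mA.
rewrite -[A in LHS]setIT -integral_indic//
  (ge0_integral_tuple_density w0 mw muE); last 2 first.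
- by apply/measurable_EFinP; exact: measurable_indic.
- by move=> x; rewrite lee_fin.
rewrite [RHS]integral_mkcond; apply: eq_integral => x _.
by rewrite patchE indicE; case: ifPn => _; rewrite ?mul1e ?mul0e.
Qed.

Lemma marginalE (n : nat) (rho : probability (n.-tuple X) R) (j : 'I_n) (A : set X) :
  marginal rho j A = rho ((@tnth n X ^~ j) @^-1` A).
Proof. by []. Qed.

Lemma measurable_tnth_preimage (n : nat) (j : 'I_n) (A : set X) :
  measurable A -> measurable ((@tnth n X ^~ j) @^-1` A).
Proof. by move=> mA; rewrite -[X in measurable X]setTI; exact: measurable_tnth. Qed.

Lemma marginal_tuple_prob (mu : probability X R) (n : nat) (j : 'I_n) (A : set X) :
  measurable A -> marginal (tuple_prob mu n) j A = mu A.
Proof.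
move=> mA; rewrite marginalE.
pose B i := if i == j then A else setT.
have -> : (@tnth n X ^~ j) @^-1` A = [set x | forall i, B i (tnth x i)].
  apply/seteqP; split => [x Ax i|x /(_ j)]; last by rewrite /B eqxx.
  by rewrite /B; case: eqP => // ->.
rewrite tuple_prob_box; last by move=> i; rewrite /B; case: ifP.
rewrite (bigD1 j)//= {1}/B eqxx big1 ?mule1// => i /negPf ij.
by rewrite /B ij probability_setT.
Qed.

Definition perm_tuple (n : nat) (s : 'S_n) (x : n.-tuple X) : n.-tuple X :=
  [tuple tnth x (s i) | i < n].

Lemma measurable_perm_tuple (n : nat) (s : 'S_n) :
  measurable_fun [set: n.-tuple X] (perm_tuple s).
Proof.
apply/measurable_fun_tnthP => i.
rewrite (_ : _ \o _ = @tnth n X ^~ (s i)); first exact: measurable_tnth.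
by apply/funext => x /=; rewrite tnth_mktuple.
Qed.

HB.instance Definition _ n (s : 'S_n) :=
  isMeasurableFun.Build _ _ _ _ (@perm_tuple n s) (@measurable_perm_tuple n s).

Lemma tuple_prob_perm (nu : probability X R) (n : nat) (s : 'S_n)
    (A : set (n.-tuple X)) :
  measurable A -> distribution (tuple_prob nu n) (perm_tuple s) A = tuple_prob nu n A.
Proof.
move: A; apply: eq_measure_box => A mA.
rewrite -[LHS]/(tuple_prob nu n (perm_tuple s @^-1` box A)).
rewrite [RHS]tuple_prob_box//.
pose B (i : 'I_n) := A (s^-1%g i).
have -> : perm_tuple s @^-1` box A = box B.
  apply/seteqP; split => x /= h i.
    by have := h (s^-1%g i); rewrite tnth_mktuple permKV.
  by rewrite tnth_mktuple; have := h (s i); rewrite /B permK.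
rewrite [RHS](reindex_inj (@perm_inj _ s^-1%g)).
by apply: (@tuple_prob_box _ _ _ nu n B) => i; exact: mA.
Qed.

(** * Marginals of a measure with a density *)

Section exchangeable_density.
Variables (n : nat) (nu : probability X R) (rho : probability (n.-tuple X) R).
Variable (p : n.-tuple X -> R).
Hypotheses (p_ge0 : forall x, 0 <= p x) (mp : measurable_fun [set: n.-tuple X] p).
Hypothesis rhoE : forall A : set (n.-tuple X), measurable A ->
  (rho A = \int[tuple_prob nu n]_(x in A) (p x)%:E)%E.

(** The product measure and p are both invariant under the transposition of i
    and j, which carries one marginal to the other. *)
Lemma exchangeable_marginal (p_perm : forall s x, p (perm_tuple s x) = p x)
    (i j : 'I_n) (A : set X) :
  measurable A -> marginal rho i A = marginal rho j A.
Proof.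
move=> mA; rewrite !marginalE.
have mA' k := measurable_tnth_preimage (k : 'I_n) mA.
rewrite !rhoE//.
pose s := tperm i j.
rewrite -(@eq_measure_integral _ _ _ _ _
  (distribution (tuple_prob nu n) (perm_tuple s))); last first.
  by move=> B mB _; exact: tuple_prob_perm.
rewrite ge0_integral_pushforward//; last 2 first.
- exact/measurable_funTS/measurable_EFinP.
- by move=> x _; rewrite lee_fin.
have -> : perm_tuple s @^-1` ((@tnth n X ^~ i) @^-1` A) = (@tnth n X ^~ j) @^-1` A.
  by apply/seteqP; split => x; rewrite /= tnth_mktuple tpermL.
by apply: eq_integral => x _ /=; rewrite p_perm.
Qed.

End exchangeable_density.

(** The density of the first marginal is p with the other coordinates integrated
    out; the bound on p passes to it because the measure integrated against is a
    probability.  The bound makes w ln w bounded later on. *)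
Lemma marginal0_density (n : nat) (nu : probability X R)
  (rho : probability (n.+1.-tuple X) R) (p : n.+1.-tuple X -> R) (B : R) :
  (forall x, 0 <= p x <= B) -> measurable_fun [set: n.+1.-tuple X] p ->
  (forall A : set (n.+1.-tuple X), measurable A ->
     rho A = \int[tuple_prob nu n.+1]_(x in A) (p x)%:E)%E ->
  exists w : X -> R, [/\ forall a, 0 <= w a <= B, measurable_fun [set: X] w &
    forall A, measurable A ->
      marginal rho ord0 A = (\int[nu]_(a in A) (w a)%:E)%E].
Proof.
move=> pB mp rhoE.
have p0 x : 0 <= p x by have /andP[] := pB x.
have mpc : measurable_fun [set: X * n.-tuple X] (EFin \o p \o @cons_pair _ X n).
  by apply: measurableT_comp => //; exact/measurable_EFinP.
pose W a := (\int[tuple_prob nu n]_y (p (cons_pair (a, y)))%:E)%E.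
have mW : measurable_fun [set: X] W.
  apply: (measurable_fun_fubini_tonelli_F (EFin \o p \o @cons_pair _ X n)) => // x.
  by rewrite lee_fin.
have W0 a : (0 <= W a)%E by apply: integral_ge0 => y _; rewrite lee_fin.
have WB a : (W a <= B%:E)%E.
  apply: (@le_trans _ _ (\int[tuple_prob nu n]_y B%:E)%E).
    apply: ge0_le_integral => //.
    - by move=> y _; rewrite lee_fin.
    - by apply: (measurableT_comp mpc); exact: measurable_pair1.
    - by move=> y _; rewrite lee_fin; have /andP[] := pB (cons_pair (a, y)).
  rewrite integral_cst// [X in (_ * X)%E](_ : _ = 1%E) ?mule1//.
  exact: probability_setT.
have WE a : ((fine (W a))%:E = W a)%E.
  by rewrite fineK// ge0_fin_numE// (le_lt_trans (WB a))// ltry.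
exists (fine \o W); split.
- by move=> a; rewrite -!lee_fin WE W0 WB.
- exact: measurableT_comp.
move=> A mA; rewrite marginalE rhoE; last exact: measurable_tnth_preimage.
rewrite integral_mkcond ge0_integral_tuple_cons//; last 2 first.
- apply/(measurable_restrictT _ _).1.
    exact: measurable_tnth_preimage.
  exact/measurable_funTS/measurable_EFinP.
- by move=> x; rewrite patchE; case: ifP; rewrite // lee_fin.
rewrite [RHS]integral_mkcond; apply: eq_integral => a _.
rewrite patchE; case: ifPn => aA.
  rewrite /= WE; apply: eq_integral => y _; rewrite patchE ifT//.
rewrite integral0_eq// => y _; rewrite patchE ifF//.
by apply/negbTE; move: aA; rewrite !notin_setE.
Qed.

End tuple_measure.
(** * The logarithmic inequality *)

(** From ln t <= t above, and from ln (1 / t) <= 1 / t below. *)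
Lemma xlnx_le (R : realType) (t B : R) : 0 <= t <= B -> `|t * ln t| <= 1 + B ^+ 2.
Proof.
move=> /andP[t0 tB].
have [->|t_neq0] := eqVneq t 0; first by rewrite mul0r normr0 addr_ge0// sqr_ge0.
have {t0 t_neq0}t0 : 0 < t by rewrite lt_def t_neq0.
have lnt_le : ln t <= t by exact/ltW/ln_sublinear.
have : ln t^-1 <= t^-1 by apply/ltW/ln_sublinear; rewrite invr_gt0.
rewrite lnV// => lnt_ge.
have ub : t * ln t <= B ^+ 2.
  apply: (@le_trans _ _ (t ^+ 2)); first by rewrite expr2 ler_pM2l.
  by rewrite ler_sqr// nnegrE ltW// (lt_le_trans t0).
have lb : - (t * ln t) <= 1.
  by rewrite -mulrN -(mulfV (lt0r_neq0 t0)) ler_pM2l.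
have B0 := sqr_ge0 B.
by rewrite ler_norml; apply/andP; split; lra.
Qed.

(** With p = D / Z and l = ln (Z q) this is (p - q) (ln D - l) >= 0.  In this form,
    with the term q ln D alone on the left, it also holds for D = 0 < q, where
    that term is -oo; all other terms are real. *)
Lemma lne_exchange_le (R : realType) (Z D q l : R) :
  0 < Z -> 0 <= D -> 0 <= q -> (q = 0 -> D = 0) -> (0 < q -> l = ln (Z * q)) ->
  (lne D%:E * q%:E <= (Z^-1 * D * ln D + (l * q - l * (Z^-1 * D)))%:E)%E.
Proof.
move=> Z0 D0 q0 qD lE.
have [q_eq0|q_neq0] := eqVneq q 0.
  by rewrite q_eq0 qD// mule0 !mulr0 mul0r subr0 addr0.
have {q_neq0} q_gt0 : 0 < q by rewrite lt_def q_neq0.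
rewrite {}lE//.
have [->|D_neq0] := eqVneq D 0.
  by rewrite le0_lneNy// gt0_mulNye ?lte_fin// leNye.
have {D_neq0} D_gt0 : 0 < D by rewrite lt_def D_neq0.
rewrite lne_EFin// -EFinM lee_fin -subr_ge0.
have -> : Z^-1 * D * ln D + (ln (Z * q) * q - ln (Z * q) * (Z^-1 * D)) - ln D * q
   = Z^-1 * ((D - Z * q) * (ln D - ln (Z * q))) by field; rewrite gt_eqF.
rewrite mulr_ge0 ?invr_ge0 ?(ltW Z0)//.
have Zq0 : 0 < Z * q by rewrite mulr_gt0.
have [le_D|/ltW le_D] := lerP (Z * q) D.
  by rewrite mulr_ge0// subr_ge0// ler_ln.
by rewrite mulr_le0// subr_le0// ler_ln.
Qed.

Section cross_entropy.
Context {d : measure_display} {T : measurableType d} {R : realType}.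
Variables (N : probability T R) (D q L : T -> R) (Z C : R).
Hypotheses (Z_gt0 : 0 < Z) (D_bnd : forall x, 0 <= D x <= C)
  (q_ge0 : forall x, 0 <= q x) (mD : measurable_fun [set: T] D)
  (mq : measurable_fun [set: T] q)
  (LE : forall x, 0 < q x -> L x = ln (Z * q x))
  (qD : {ae N, forall x, q x = 0 -> D x = 0})
  (iLp : N.-integrable [set: T] (fun x => (L x * (Z^-1 * D x))%:E))
  (iLq : N.-integrable [set: T] (fun x => (L x * q x)%:E))
  (LpLq : (\int[N]_x (L x * (Z^-1 * D x))%:E = \int[N]_x (L x * q x)%:E)%E).

Lemma lne_cross_entropy_le :
  (\int[N]_x (lne (D x)%:E * (q x)%:E) <=
   \int[N]_x (lne (D x)%:E * (Z^-1 * D x)%:E))%E.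
Proof.
have lnD x : (lne (D x)%:E * (Z^-1 * D x)%:E)%E = (Z^-1 * D x * ln (D x))%:E.
  have /andP[] := D_bnd x; rewrite le_eqVlt => /predU1P[<- _|D0 _].
    by rewrite mulr0 mule0 mul0r.
  by rewrite lne_EFin// -EFinM mulrC.
have mDlnD : measurable_fun [set: T] (fun x => Z^-1 * D x * ln (D x)).
  apply: measurable_funM; first exact: measurable_funM.
  exact: measurableT_comp.
have iDlnD : N.-integrable [set: T] (fun x => (Z^-1 * D x * ln (D x))%:E).
  apply: (@le_integrable _ _ _ N _ measurableT _ (fun=> (Z^-1 * (1 + C ^+ 2))%:E)).
  - exact/measurable_EFinP.
  - move=> x _; rewrite /= lee_fin -mulrA normrM ger0_norm; last by rewrite invr_ge0 ltW.
    rewrite [leRHS]ger0_norm; last first.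
      by rewrite mulr_ge0 ?invr_ge0 ?(ltW Z_gt0)// addr_ge0// sqr_ge0.
    by rewrite ler_pM2l ?invr_gt0// xlnx_le.
  - exact: finite_measure_integrable_cst.
have iLqLp : N.-integrable [set: T] (fun x => (L x * q x - L x * (Z^-1 * D x))%:E).
  under [X in _.-integrable _ X]funext do rewrite EFinB.
  exact: integrableB.
have -> : (\int[N]_x (lne (D x)%:E * (Z^-1 * D x)%:E) =
   \int[N]_x (Z^-1 * D x * ln (D x) + (L x * q x - L x * (Z^-1 * D x)))%:E)%E.
  under eq_integral do rewrite lnD.
  under [RHS]eq_integral do rewrite EFinD.
  rewrite integralD//.
  under [X in (_ + X)%E]eq_integral do rewrite EFinB.
  rewrite integralB// LpLq subee ?adde0//.
  exact: integrable_fin_num.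
apply: le_integral_ae.
- apply: emeasurable_funM; last exact/measurable_EFinP.
  exact: measurable_lne_EFin.
- apply: (measurable_int N).
  under [X in _.-integrable _ X]funext do rewrite EFinD.
  exact: integrableD.
- apply: filterS qD => x qDx.
  by have /andP[? ?] := D_bnd x; apply: lne_exchange_le => //; exact: LE.
Qed.

End cross_entropy.

(** * Sums of functions of one coordinate *)

(** The expectation of a sum of functions of one coordinate each depends on the
    marginals only.  This is what makes rho and mu^n indistinguishable to
    L = ln Z + \sum_j ln (w (x_j)). *)
Section prescribed_marginals.
Context {dX : measure_display} {X : measurableType dX} {R : realType}.
Variables (mu : probability X R) (n : nat) (P : probability (n.-tuple X) R).
Hypothesis PE : forall j A, measurable A -> marginal P j A = mu A.

Lemma integral_tnth (g : X -> \bar R) (j : 'I_n) :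
  measurable_fun [set: X] g ->
  (\int[P]_x g (tnth x j) = \int[mu]_a g a)%E.
Proof.
move=> mg; rewrite -(@eq_measure_integral _ _ _ _ _ (marginal P j)); last first.
  by move=> A mA _; exact: PE.
exact/esym/integral_rv_law.
Qed.

Lemma integrable_tnth (g : X -> \bar R) (j : 'I_n) :
  mu.-integrable [set: X] g -> P.-integrable [set: n.-tuple X] (fun x => g (tnth x j)).
Proof.
move=> /integrableP[mg goo]; apply/integrableP; split.
  by apply: measurableT_comp => //; exact: measurable_tnth.
by rewrite (integral_tnth (g := abse \o g))//; exact: measurableT_comp.
Qed.

Variables (g : X -> R) (c : R).
Hypothesis ig : mu.-integrable [set: X] (EFin \o g).

Lemma integrable_sum_tnth :
  P.-integrable [set: n.-tuple X] (fun x => (c + \sum_(j < n) g (tnth x j))%:E).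
Proof.
under [X in _.-integrable _ X]funext do rewrite EFinD -sumEFin.
apply: integrableD => //; first exact: finite_measure_integrable_cst.
apply: integrable_sum => // j _; exact: integrable_tnth ig.
Qed.

Lemma integral_sum_tnth :
  (\int[P]_x (c + \sum_(j < n) g (tnth x j))%:E =
   c%:E + \sum_(j < n) \int[mu]_a (g a)%:E)%E.
Proof.
under eq_integral do rewrite EFinD -sumEFin.
rewrite integralD//; last 2 first.
- exact: finite_measure_integrable_cst.
- apply: integrable_sum => // j _; exact: integrable_tnth ig.
rewrite integral_cst// [X in (_ * X)%E](_ : _ = 1%E) ?mule1; last exact: probability_setT.
congr (_ + _)%E.
rewrite integral_sum//; last by move=> j; exact: integrable_tnth ig.
by apply: eq_bigr => j _; rewrite (integral_tnth (g := EFin \o g))//;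
  exact: measurable_int ig.
Qed.

End prescribed_marginals.
(** * Comparison with the product of the marginals *)

Lemma ln_prod (R : realType) (I : Type) (s : seq I) (F : I -> R) :
  (forall i, 0 < F i) -> ln (\prod_(i <- s) F i) = \sum_(i <- s) ln (F i).
Proof.
move=> F0; elim: s => [|i s IHs]; first by rewrite !big_nil ln1.
by rewrite !big_cons lnM ?IHs// posrE// prodr_gt0.
Qed.

(** The inequality for any bounded symmetric density D / Z: the kernel and the
    projections enter through the bounds and the symmetry of D = det G^x alone. *)
Theorem exchangeable_marginals_lne_le (dX : measure_display) (X : measurableType dX)
    (R : realType) (n : nat) (nu : probability X R)
    (rho : probability (n.-tuple X) R) (D : n.-tuple X -> R) (Z C : R) (i : 'I_n) :
  0 < Z -> (forall x, 0 <= D x <= C) -> measurable_fun [set: n.-tuple X] D ->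
  (forall s x, D (perm_tuple s x) = D x) ->
  (forall A : set (n.-tuple X), measurable A ->
    rho A = (\int[tuple_prob nu n]_(x in A) (Z^-1 * D x)%:E)%E) ->
  (\int[tuple_prob (marginal rho i) n]_x lne (D x)%:E
     <= \int[rho]_x lne (D x)%:E)%E.
Proof.
case: n rho D i => [|n] rho D i; first by case: i.
move=> Z0 D_bnd mD D_perm rhoE.
have D0 x : 0 <= D x by have /andP[] := D_bnd x.
pose B := Z^-1 * C.
have p_bnd x : 0 <= Z^-1 * D x <= B.
  by have /andP[? ?] := D_bnd x; rewrite mulr_ge0 ?ler_pM2l ?invr_gt0// invr_ge0 ltW.
have p0 x : 0 <= Z^-1 * D x by have /andP[] := p_bnd x.
have mp : measurable_fun [set: n.+1.-tuple X] (fun x => Z^-1 * D x).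
  exact: measurable_funM.
pose mu := marginal rho i.
have muE j A : measurable A -> marginal rho j A = mu A.
  by apply: (exchangeable_marginal p0 mp rhoE) => s x; rewrite D_perm.
have [w [w_bnd mw w_mu0]] := marginal0_density p_bnd mp rhoE.
have w0 a : 0 <= w a by have /andP[] := w_bnd a.
have w_mu A : measurable A -> (mu A = \int[nu]_(a in A) (w a)%:E)%E.
  by move=> mA; rewrite -(muE ord0 A mA) w_mu0.
pose q (x : n.+1.-tuple X) := \prod_(j < n.+1) w (tnth x j).
have q0 x : 0 <= q x by apply: prodr_ge0.
have mq : measurable_fun [set: n.+1.-tuple X] q.
  by apply: measurable_prod => j _; apply: measurableT_comp => //; exact: measurable_tnth.
have qE := tuple_prob_density (n := n.+1) w0 mw w_mu.
(* Against nu the integrand is w |ln w|, and w <= B. *)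
have ilnw : mu.-integrable [set: X] (EFin \o (fun a => ln (w a))).
  have mlnw : measurable_fun [set: X] (fun a => ln (w a)) by exact: measurableT_comp.
  apply/integrableP; split; first exact/measurable_EFinP.
  rewrite (ge0_integral_density w0 mw w_mu)//; last first.
    by apply/measurable_EFinP; exact: measurableT_comp.
  apply: (@le_lt_trans _ _ (\int[nu]_a (1 + B ^+ 2)%:E)%E).
    apply: ge0_le_integral => //.
    - by move=> a _; rewrite mule_ge0// lee_fin.
    - apply: emeasurable_funM; last exact/measurable_EFinP.
      by apply/measurable_EFinP; exact: measurableT_comp.
    - move=> a _; rewrite /= -EFinM lee_fin -[X in _ * X]ger0_norm// -normrM mulrC.
      exact: xlnx_le.
  rewrite integral_cst// [X in (_ * X)%E](_ : _ = 1%E) ?mule1 ?ltry//.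
  exact: probability_setT.
pose L (x : n.+1.-tuple X) := ln Z + \sum_(j < n.+1) ln (w (tnth x j)).
have muE' j A : measurable A -> marginal (tuple_prob mu n.+1) j A = mu A.
  exact: marginal_tuple_prob.
have iLrho := integrable_sum_tnth muE (ln Z) ilnw.
have iLmu := integrable_sum_tnth muE' (ln Z) ilnw.
have LL := etrans (integral_sum_tnth muE (ln Z) ilnw)
  (esym (integral_sum_tnth muE' (ln Z) ilnw)).
have mL : measurable_fun [set: n.+1.-tuple X] (fun x => (L x)%:E).
  exact: measurable_int iLrho.
have mlneD := measurable_lne_EFin mD.
rewrite (integral_density q0 mq qE)// (integral_density p0 mp rhoE)//.
apply: (lne_cross_entropy_le (L := L) Z0 D_bnd q0 mD mq).
- move=> x qx_gt0.
  have w_gt0 j : 0 < w (tnth x j).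
    rewrite lt_def w0 andbT; apply/eqP => wj0.
    by move: qx_gt0; rewrite /q (bigD1 j)//= wj0 mul0r ltxx.
  by rewrite lnM ?posrE// ln_prod.
(* Where q = 0 some w (x_j) = 0, and rho {w (x_j) = 0} = mu {w = 0}, which is the
   integral of w over {w = 0}. *)
- have : {ae tuple_prob nu n.+1, forall x (j : 'I_n.+1), w (tnth x j) = 0 -> D x = 0}.
    pose S j := (@tnth n.+1 X ^~ j) @^-1` (w @^-1` [set 0]).
    have mw0 : measurable (w @^-1` [set 0]).
      by rewrite -[X in measurable X]setTI; exact: mw.
    have mS j : measurable (S j) by exact: measurable_tnth_preimage.
    have : forall j, {ae tuple_prob nu n.+1, forall x, S j x -> D x = 0}.
      move=> j.
      have : (\int[tuple_prob nu n.+1]_(x in S j) `|(Z^-1 * D x)%:E| = 0)%E.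
        under eq_integral do rewrite gee0_abs ?lee_fin//.
        rewrite -rhoE// -[LHS]/(marginal rho j (w @^-1` [set 0])) muE// w_mu//.
        by apply: integral0_eq => a /= ->.
      have mpS : measurable_fun (S j) (fun x => (Z^-1 * D x)%:E).
        exact/measurable_funTS/measurable_EFinP.
      move=> /(ae_eq_integral_abs _ (mS j) mpS); apply: filterS => x SD /SD[] /eqP.
      by rewrite mulf_eq0 invr_eq0 gt_eqF//= => /eqP.
    by move/filter_forall; apply: filterS => x.
  apply: filterS => x SD /eqP; rewrite prodf_seq_eq0 => /hasP[j _ /= /eqP].
  exact: SD.
- exact: integrable_density p0 mp rhoE _ iLrho.
- exact: integrable_density q0 mq qE _ iLmu.
- have := LL.
  by rewrite (integral_density p0 mp rhoE)// (integral_density q0 mq qE).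
Qed.

Theorem theorem20 (R : realType) (dX : measure_display) (X : measurableType dX)
    (V : rkhs R X) (d n : nat) (Vd : set V) (b : 'I_d -> V)
    (Vd_b : orthonormal_basis Vd b)
    (mdetG : measurable_fun [set: n.-tuple X]
               (fun x : n.-tuple X => \det (Gmx b x)))
    (nu : probability X R) (Z : R)
    (ZE : (\int[tuple_prob nu n]_x (\det (Gmx b x))%:E)%E = Z%:E)
    (Z_gt0 : 0 < Z)
    (rho : probability (n.-tuple X) R)
    (rhoE : forall A : set (n.-tuple X), measurable A ->
       rho A = (\int[tuple_prob nu n]_(x in A) (Z^-1 * \det (Gmx b x))%:E)%E)
    (i : 'I_n)
    (d1 : measure_display) (O1 : measurableType d1) (P1 : probability O1 R)
    (x : {RV P1 >-> n.-tuple X})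
    (x_law : forall A : set (n.-tuple X), measurable A ->
       distribution P1 x A = rho A)
    (d2 : measure_display) (O2 : measurableType d2) (P2 : probability O2 R)
    (xt : {RV P2 >-> n.-tuple X})
    (xt_law : forall A : set (n.-tuple X), measurable A ->
       distribution P2 xt A = tuple_prob (marginal rho i) n A) :
  (\int[P2]_w lne (\det (Gmx b (xt w)))%:E
     <= \int[P1]_w lne (\det (Gmx b (x w)))%:E)%E.

Proof.
have b1 j : rkhs_dot V (b j) (b j) <= 1 by rewrite Vd_b.1 eqxx.
have mlneD := measurable_lne_EFin mdetG.
have -> : (\int[P2]_w lne (\det (Gmx b (xt w)))%:E =
    \int[tuple_prob (marginal rho i) n]_y lne (\det (Gmx b y))%:E)%E.
  rewrite -(integral_rv_law xt mlneD); apply: eq_measure_integral => A mA _.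
  exact: xt_law.
have -> : (\int[P1]_w lne (\det (Gmx b (x w)))%:E =
    \int[rho]_y lne (\det (Gmx b y))%:E)%E.
  rewrite -(integral_rv_law x mlneD); apply: eq_measure_integral => A mA _.
  exact: x_law.
apply: (@exchangeable_marginals_lne_le _ _ _ _ nu rho _ Z d`!%:R) => //.
- by move=> y; rewrite det_Gmx_ge0 det_Gmx_le.
- by move=> s y; rewrite /perm_tuple Gmx_perm.
Qed.
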